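(* Let $C\subseteq\mathbb{R}^n$ be nonempty, closed and convex, and let $f_1,f_2:\mathbb{R}^n\to\mathbb{R}$ be such that $f_1$ is $\mu_1$-strongly convex and $f_2$ is $\mu_2$-strongly convex, where $\mu_1,\mu_2\ge0$ and $\mu_1+\mu_2>0$. Let $h:=f_1-f_2$ be bounded below on $C$, and put $h^*:=\inf_{x\in C}h(x)$. Let $\{x^k\}$ and $\{z^{k+1}\}$ be generated by the augmented algorithm described in the context with the DCA oracle described there. Then, after $N\ge1$ iterations, $$\min_{0\le k\le N-1}\|x^k-z^{k+1}\|\le\sqrt{\frac{2\,(h(x^0)-h^* )}{(\mu_1+\mu_2)\,N}}.$$
   Context: DCA oracle. Given $x^k\in C$, pick a subgradient $g_2^k\in\partial f_2(x^k)$ (convex subdifferential) and return a point $$z^{k+1}\in\arg\min_{x\in C}\; f_1(x)-\langle g_2^k,x\rangle$$ (such minimizers are assumed to exist). A function is $\mu$-strongly convex if $f-\frac{\mu}{2}\|\cdot\|^2$ is convex ($\mu=0$ meaning convex). Augmented algorithm. Let $L$ be the linear subspace parallel to the affine hull of $C$, and $S^{n-1}$ the Euclidean unit sphere. Given $x^0\in C$, $\gamma>0$ and $r\in(0,\infty)$, for $k=0,1,2,\dots$: 1. Sample a direction $v^k_{ex}$ from a distribution $\mathcal{D}_v$ with support $S^{n-1}\cap L$ and a step size $\hat t^k$ from a distribution $\mathcal{D}_t$ with support $[0,r]$. 2. Set $t^k_{ex}:=\hat t^k$ if $x^k+\hat t^k v^k_{ex}\in C$ and $h(x^k+\hat t^k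 v^k_{ex})+\frac{\gamma}{2}(\hat t^k)^2<h(x^k)$, and $t^k_{ex}:=0$ otherwise. Set $y^{k+1}:=x^k+t^k_{ex}v^k_{ex}$. 3. Let $z^{k+1}$ be the oracle output at $x^k$. 4. Choose $x^{k+1}\in\arg\min_{u\in\{y^{k+1},z^{k+1}\}}h(u)$. If $C$ is a singleton nothing is sampled and $y^{k+1}:=x^k$. The bound holds for every realization of the samples. *)

(* Defs.v *)
From HB Require Import structures.
From mathcomp Require Import all_boot all_order all_algebra.
From mathcomp Require Import all_classical all_reals all_analysis.

Set Implicit Arguments.
Unset Strict Implicit.
Unset Printing Implicit Defensive.

Import Order.TTheory GRing.Theory Num.Theory numFieldNormedType.Exports.

Local Open Scope classical_set_scope.
Local Open Scope ring_scope.

(* R^n is 'rV[R]_n. The library norm on 'rV[R]_n is the sup norm, so the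
   Euclidean structure is defined here; both norms induce the same topology. *)

Definition dot (R : realType) (n : nat) (u v : 'rV[R]_n) : R :=
  \sum_(i < n) u 0 i * v 0 i.

Definition enorm (R : realType) (n : nat) (u : 'rV[R]_n) : R :=
  Num.sqrt (dot u u).

Definition esphere (R : realType) (n : nat) : set 'rV[R]_n :=
  [set u | enorm u = 1].

Definition affine_hull (R : realType) (n : nat) (A : set 'rV[R]_n) :
    set 'rV[R]_n :=
  [set u | exists (m : nat) (a : 'I_m -> R) (p : 'I_m -> 'rV[R]_n),
     [/\ forall i, A (p i), \sum_(i < m) a i = 1
       & u = \sum_(i < m) a i *: p i]].

Definition parallel (R : realType) (n : nat) (L : {vspace 'rV[R]_n})
    (A : set 'rV[R]_n) : Prop :=
  exists a : 'rV[R]_n, A = [set a + u | u in [set` L]].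

Definition strongly_convex (R : realType) (n : nat) (mu : R)
    (f : 'rV[R]_n -> R) : Prop :=
  convex_function [set: 'rV[R]_n] (fun u => f u - mu / 2 * enorm u ^+ 2).

Definition subdifferential (R : realType) (n : nat) (f : 'rV[R]_n -> R)
    (u : 'rV[R]_n) : set 'rV[R]_n :=
  [set g | forall w, f u + dot g (w - u) <= f w].

Definition argmin (R : realType) (T : Type) (A : set T) (f : T -> R) : set T :=
  [set u | A u /\ forall w, A w -> f u <= f w].

Definition dca_oracle (R : realType) (n : nat) (C : set 'rV[R]_n)
    (f1 f2 : 'rV[R]_n -> R) (x z : 'rV[R]_n) : Prop :=
  exists2 g, subdifferential f2 x g & argmin C (fun u => f1 u - dot g u) z.

Notation borel_rV R n := (g_sigma_algebraType (@open 'rV[R]_n)).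

Definition measure_support (R : realType) (T : topologicalType)
    (mu : set T -> \bar R) : set T :=
  [set u | forall U, open_nbhs u U -> (0 < mu U)%E].

(* The values of a library measure on non-measurable sets are irrelevant. *)
Definition has_law (R : realType) d d' (Omega : measurableType d)
    (T : measurableType d') (P : probability Omega R)
    (X : {RV P >-> T}) (D : probability T R) : Prop :=
  forall A, measurable A -> distribution P X A = D A.

Definition is_singleton (T : Type) (A : set T) : Prop :=
  exists a, A = [set a].

Definition ex_step (R : realType) (n : nat) (C : set 'rV[R]_n)
    (h : 'rV[R]_n -> R) (gamma : R) (x v : 'rV[R]_n) (t : R) : R :=
  if `[< C (x + t *: v) /\ h (x + t *: v) + gamma / 2 * t ^+ 2 < h x >]
  then t else 0.

Definition explore (R : realType) (n : nat) (C : set 'rV[R]_n)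
    (h : 'rV[R]_n -> R) (gamma : R) (x v : 'rV[R]_n) (t : R) : 'rV[R]_n :=
  if `[< is_singleton C >] then x else x + ex_step C h gamma x v t *: v.

(* One run of the algorithm, driven by the sampled directions v and step
   sizes t. The values y 0 and z 0 play no role. *)
Definition augmented_dca (R : realType) (n : nat) (C : set 'rV[R]_n)
    (f1 f2 : 'rV[R]_n -> R) (gamma : R) (v : nat -> 'rV[R]_n) (t : nat -> R)
    (x y z : nat -> 'rV[R]_n) : Prop :=
  let h := fun u => f1 u - f2 u in
  C (x 0%N) /\
  forall k, [/\ y k.+1 = explore C h gamma (x k) (v k) (t k),
                dca_oracle C f1 f2 (x k) (z k.+1)
              & argmin [set y k.+1; z k.+1] h (x k.+1)].

(* Main.v *)
(* Let Q u := f1 u - <g, u> with g a subgradient of f2 at x. Strong convexity of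
   f1 makes Q grow quadratically around its minimizer z over C, and strong
   convexity of f2 makes f2 - <g, .> grow quadratically around its minimizer x.
   Adding the two growth inequalities at x and z gives the descent
     (mu1 + mu2) / 2 * |x - z|^2 <= h x - h z,
   and the next iterate has an h value at most h z, whatever was sampled.
   Telescoping and bounding the minimum by the quadratic mean concludes. *)
Require Import Defs.
From HB Require Import structures.
From mathcomp Require Import all_boot all_order all_algebra.
From mathcomp Require Import all_classical all_reals all_analysis.
From mathcomp Require Import ring lra.

Set Implicit Arguments.
Unset Strict Implicit.
Unset Printing Implicit Defensive.

Import Order.TTheory GRing.Theory Num.Theory numFieldNormedType.Exports.

Local Open Scope classical_set_scope.
Local Open Scope ring_scope.

Lemma dotBr (R : realType) (n : nat) (g u v : 'rV[R]_n) :
  dot g (u - v) = dot g u - dot g v.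
Proof.
by rewrite /dot -sumrB; apply: eq_bigr => i _; rewrite !mxE; ring.
Qed.

Lemma dotDZr (R : realType) (n : nat) (g u v : 'rV[R]_n) (a b : R) :
  dot g (a *: u + b *: v) = a * dot g u + b * dot g v.
Proof.
rewrite /dot !mulr_sumr -big_split /=.
by apply: eq_bigr => i _; rewrite !mxE; ring.
Qed.

Lemma sqr_enorm (R : realType) (n : nat) (u : 'rV[R]_n) :
  enorm u ^+ 2 = dot u u.
Proof.
by rewrite sqr_sqrtr// sumr_ge0// => i _; rewrite -expr2 sqr_ge0.
Qed.

(** A polynomial identity in each coordinate. It turns convexity of [f - mu / 2 * enorm ^+ 2] into
    the strong convexity inequality with an explicit quadratic gain. *)
Lemma sqr_enorm_conv (R : realType) (n : nat) (u v : 'rV[R]_n) (t : R) :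
  enorm (t *: u + (1 - t) *: v) ^+ 2 =
  t * enorm u ^+ 2 + (1 - t) * enorm v ^+ 2
  - t * (1 - t) * enorm (u - v) ^+ 2.
Proof.
rewrite !sqr_enorm /dot !mulr_sumr -big_split -sumrB /=.
by apply: eq_bigr => i _; rewrite !mxE; ring.
Qed.

Lemma enormBC (R : realType) (n : nat) (u v : 'rV[R]_n) :
  enorm (u - v) = enorm (v - u).
Proof.
congr Num.sqrt; rewrite /dot.
by apply: eq_bigr => i _; rewrite !mxE; ring.
Qed.

Lemma strongly_convex_conv (R : realType) (n : nat) (mu : R)
    (f : 'rV[R]_n -> R) (u v : 'rV[R]_n) (t : R) :
  strongly_convex mu f -> 0 <= t -> t <= 1 ->
  f (t *: u + (1 - t) *: v) <=
  t * f u + (1 - t) * f v - mu / 2 * (t * (1 - t) * enorm (u - v) ^+ 2).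
Proof.
move=> f_sc t_ge0 t_le1.
have := f_sc (Itv01 t_ge0 t_le1) u v (in_setT _) (in_setT _).
rewrite convRE /conv /= /unstable.onem sqr_enorm_conv; lra.
Qed.

Lemma convex_set_conv (R : realType) (n : nat) (A : set 'rV[R]_n)
    (u v : 'rV[R]_n) (t : R) :
  convex_set A -> A u -> A v -> 0 <= t -> t <= 1 ->
  A (t *: u + (1 - t) *: v).
Proof.
move=> A_convex Au Av t_ge0 t_le1.
have := A_convex u v (Itv01 t_ge0 t_le1).
by rewrite !in_setE => /(_ Au Av).
Qed.

(** Compare the minimizer [v] with [t *: u + (1 - t) *: v], which stays in [A]: minimality and
    strong convexity, divided by [t], give [(1 - t) * D <= G]. Letting [t] tend to 0 yields
    [D <= G]. *)
Lemma argmin_quadratic_growth (R : realType) (n : nat) (A : set 'rV[R]_n)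
    (mu : R) (f : 'rV[R]_n -> R) (g u v : 'rV[R]_n) :
  convex_set A -> strongly_convex mu f ->
  argmin A (fun w => f w - dot g w) v -> A u ->
  f v - dot g v + mu / 2 * enorm (u - v) ^+ 2 <= f u - dot g u.
Proof.
move=> A_convex f_sc [Av v_min] Au.
set D := mu / 2 * _; set G := f u - dot g u - (f v - dot g v).
have growth t : 0 < t -> t <= 1 -> (1 - t) * D <= G.
  move=> t_gt0 t_le1; have t_ge0 := ltW t_gt0.
  have := v_min _ (convex_set_conv A_convex Au Av t_ge0 t_le1).
  have := strongly_convex_conv u v f_sc t_ge0 t_le1.
  rewrite -[_ <= G](ler_pM2l t_gt0) dotDZr /D /G; lra.
suff : D <= G by rewrite /G; lra.
rewrite leNgt; apply/negP => GD.
have G_ge0 : 0 <= G by rewrite subr_ge0 v_min.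
have D_gt0 : 0 < D by exact: le_lt_trans GD.
(* One explicit [t] replaces the limit: it makes [(1 - t) * D] the midpoint of [G] and [D], which
   exceeds [G] when [G < D]. *)
have t_gt0 : 0 < (D - G) / (2 * D) by apply: divr_gt0; lra.
have t_le1 : (D - G) / (2 * D) <= 1 by rewrite ler_pdivrMr; lra.
have := growth _ t_gt0 t_le1.
have -> : (1 - (D - G) / (2 * D)) * D = (D + G) / 2.
  by field; rewrite gt_eqF.
lra.
Qed.

Lemma dca_oracle_descent (R : realType) (n : nat) (C : set 'rV[R]_n)
    (f1 f2 : 'rV[R]_n -> R) (mu1 mu2 : R) (x z : 'rV[R]_n) :
  convex_set C -> strongly_convex mu1 f1 -> strongly_convex mu2 f2 ->
  C x -> dca_oracle C f1 f2 x z ->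
  (mu1 + mu2) / 2 * enorm (x - z) ^+ 2 <= f1 x - f2 x - (f1 z - f2 z).
Proof.
move=> C_convex f1_sc f2_sc Cx [g g_sub z_min].
(* The subgradient inequality at [x] is a minimality statement over the whole space, so the growth
   lemma also covers [f2]. *)
have x_min : argmin setT (fun u => f2 u - dot g u) x.
  by split=> // u _; have := g_sub u; rewrite dotBr; lra.
have convT : convex_set [set: 'rV[R]_n] by move=> *; rewrite in_setT.
have := argmin_quadratic_growth convT f2_sc x_min (I : setT z).
have := argmin_quadratic_growth C_convex f1_sc z_min Cx.
rewrite (enormBC z x); lra.
Qed.

(** A nonzero step is kept only after its endpoint has been tested to lie in [C]. *)
Lemma explore_in (R : realType) (n : nat) (C : set 'rV[R]_n)
    (h : 'rV[R]_n -> R) (gamma : R) (x v : 'rV[R]_n) (t : R) :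
  C x -> C (explore C h gamma x v t).
Proof.
move=> Cx; rewrite /explore /ex_step.
by case: ifP => // _; case: asboolP => [[]|_] //; rewrite scale0r addr0.
Qed.

Lemma augmented_dca_in (R : realType) (n : nat) (C : set 'rV[R]_n)
    (f1 f2 : 'rV[R]_n -> R) (gamma : R) (v : nat -> 'rV[R]_n) (t : nat -> R)
    (x y z : nat -> 'rV[R]_n) (k : nat) :
  augmented_dca C f1 f2 gamma v t x y z -> C (x k).
Proof.
case=> Cx0 step; elim: k => // k Cxk.
have [y_def [g _ [Cz _]] [[->|->] _]] := step k => //.
by rewrite y_def; exact: explore_in.
Qed.

(** The minimum [m] is nonnegative and below every term, so [N] copies of [c * m ^+ 2] sum to at
    most [S]. The default [a0] takes part in the minimum, so its sign matters too. *)
Lemma bigmin_le_root_mean_square (R : realType) (a : nat -> R) (a0 S c : R)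
    (N : nat) :
  0 < c -> (0 < N)%N -> 0 <= a0 -> (forall k, 0 <= a k) ->
  \sum_(0 <= k < N) c * a k ^+ 2 <= S ->
  \big[Num.min/a0]_(0 <= k < N) a k <= Num.sqrt (S / (c * N%:R)).
Proof.
move=> c_gt0 N_gt0 a0_ge0 a_ge0 aS.
set m := \big[_/_]_(_ <= _ < _) _.
have m_ge0 : 0 <= m by apply: le_bigmin.
rewrite -(ger0_norm m_ge0) -sqrtr_sqr ler_wsqrtr//.
rewrite ler_pdivlMr ?mulr_gt0 ?ltr0n//; apply: le_trans aS.
have -> : m ^+ 2 * (c * N%:R) = \sum_(0 <= k < N) c * m ^+ 2.
  by rewrite sumr_const_nat subn0 -mulr_natr; ring.
rewrite !big_nat; apply: ler_sum => k kN.
rewrite ler_pM2l// ler_sqr ?nnegrE//.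
by apply: ge_bigmin_seq => //; rewrite mem_index_iota.
Qed.

Theorem theorem5p1 (R : realType) (n : nat)
  (C : set 'rV[R]_n) (C_neq0 : C !=set0) (C_closed : closed C)
  (C_convex : convex_set C)
  (f1 f2 : 'rV[R]_n -> R) (mu1 mu2 : R)
  (mu1_ge0 : 0 <= mu1) (mu2_ge0 : 0 <= mu2) (mu_gt0 : 0 < mu1 + mu2)
  (f1_sc : strongly_convex mu1 f1) (f2_sc : strongly_convex mu2 f2)
  (h := fun u : 'rV[R]_n => f1 u - f2 u)
  (h_lb : has_lbound (h @` C))
  (hstar := inf (h @` C))
  (L : {vspace 'rV[R]_n}) (L_parallel : parallel L (affine_hull C))
  (gamma r : R) (gamma_gt0 : 0 < gamma) (r_gt0 : 0 < r)
  (Dv : probability (borel_rV R n) R) (Dt : probability R R)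
  (d : measure_display) (Omega : measurableType d) (P : probability Omega R)
  (v : nat -> {RV P >-> borel_rV R n}) (t : nat -> {RV P >-> R})
  (sampling : ~ is_singleton C ->
     [/\ measure_support (T := 'rV[R]_n) Dv = @esphere R n `&` [set` L],
         measure_support (T := R) Dt = [set` `[0, r]],
         forall k, has_law (v k) Dv
       & forall k, has_law (t k) Dt])
  (w : Omega) (x y z : nat -> 'rV[R]_n)
  (run : augmented_dca C f1 f2 gamma (fun k => v k w) (fun k => t k w) x y z)
  (N : nat) (N_ge1 : (1 <= N)%N) :
  \big[Num.min/enorm (x 0%N - z 1%N)]_(0 <= k < N) enorm (x k - z k.+1)
    <= Num.sqrt (2 * (h (x 0%N) - hstar) / ((mu1 + mu2) * N%:R)).
Proof.
have Cx k : C (x k) by exact: augmented_dca_in run.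
(* The right-hand side is an increment of [- h], the shape that telescoping expects. *)
have descent k : (mu1 + mu2) / 2 * enorm (x k - z k.+1) ^+ 2 <=
    - h (x k.+1) - - h (x k).
  have [_ oracle [_ x_min]] := run.2 k.
  have := dca_oracle_descent C_convex f1_sc f2_sc (Cx k) oracle.
  (* Only the comparison with the oracle point is used, so the bound holds for every sample. *)
  have := x_min (z k.+1) (or_intror erefl).
  rewrite /h; lra.
have hstar_le : hstar <= h (x N) by apply: ge_inf => //; exists (x N).
have -> : 2 * (h (x 0%N) - hstar) / ((mu1 + mu2) * N%:R) =
    (h (x 0%N) - hstar) / ((mu1 + mu2) / 2 * N%:R).
  by field; rewrite pnatr_eq0 -lt0n N_ge1 gt_eqF.
(* The default of the minimum is its term at [k = 0], present since [N] is positive, so it does not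
   alter the value. *)
apply: (bigmin_le_root_mean_square (a := fun k => enorm (x k - z k.+1))
  (S := h (x 0%N) - hstar) (c := (mu1 + mu2) / 2)) => //.
- by rewrite divr_gt0.
- by rewrite sqrtr_ge0.
- by move=> k; rewrite sqrtr_ge0.
apply: (@le_trans _ _ (\sum_(0 <= k < N) (- h (x k.+1) - - h (x k)))).
  exact: ler_sum.
by rewrite (telescope_sumr (fun k => - h (x k)))//; lra.
Qed.
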